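(* Let $\tau:[0,\infty)\to[0,\infty)$ be continuous with $\lim_{t\to\infty}\{t-\tau(t)\}=\infty$, let $-\bar{\tau}=\inf_{t\ge 0}\{t-\tau(t)\}$, and suppose $\lim_{t\to\infty}\tau(t)/t=0$. Let $a>b>0$ and let $g:[0,\infty)\to[0,\infty)$ be continuous with $g(0)=0$, $g(x)>0$ for $x>0$, such that there is $\delta_1>0$ for which $g$ is increasing on $(0,\delta_1)$, and there is $\beta>1$ with $g\in\mathrm{RV}_0(\beta)$. Let $\psi\in C([-\bar\tau,0];(0,\infty))$. If the solution $x$ of $$x'(t)=-ag(x(t))+bg(x(t-\tau(t))),\quad t\ge 0;\qquad x(t)=\psi(t),\quad t\in[-\bar\tau,0],$$ obeys $x(t)\to0$ as $t\to\infty$, and $G(x)=\int_x^1\frac{1}{g(u)}\,du$ for $x>0$, then $$\lim_{t\to\infty}\frac{G(x(t))}{t}=a-b.$$ Moreover $$\lim_{t\to\infty}\frac{x(t)}{G^{-1}(t)}=(a-b)^{-1/(\beta-1)}.$$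
   Context: A function $f$, positive near $0$ on the right, is regularly varying at zero with exponent $\alpha\in\mathbb{R}$, written $f\in\mathrm{RV}_0(\alpha)$, if $\lim_{t\to0^+}f(\lambda t)/f(t)=\lambda^\alpha$ for all $\lambda>0$. A solution of the delay equation is a continuous function $x:[-\bar\tau,\infty)\to(0,\infty)$, differentiable on $[0,\infty)$ (one-sided at $0$), satisfying the equation for all $t\ge0$ and equal to $\psi$ on $[-\bar\tau,0]$; solutions are positive. $G$ is strictly decreasing on $(0,\infty)$ with $G(x)\to\infty$ as $x\to0^+$, and $G^{-1}$ is its inverse. *)

(* Defs.v *)
(* Stdlib reals with Coquelicot.  Functions with a restricted domain are total
   functions R -> R; every condition below only looks at their values on the
   intended domain. *)
From Stdlib Require Import Reals.
From Coquelicot Require Import Coquelicot.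
Open Scope R_scope.

Definition RV0 (alpha : R) (f : R -> R) : Prop :=
  at_right 0 (fun t => 0 < f t) /\
  forall lambda, 0 < lambda ->
    filterlim (fun t => f (lambda * t) / f t) (at_right 0)
      (locally (Rpower lambda alpha)).

Definition is_right_derive (f : R -> R) (t l : R) : Prop :=
  filterlim (fun s => (f s - f t) / (s - t)) (at_right t) (locally l).

(* The derivative is two-sided at t > 0 and one-sided at t = 0. *)
Definition is_solution (tau g : R -> R) (a b taubar : R) (psi x : R -> R)
  : Prop :=
  let rhs t := - a * g (x t) + b * g (x (t - tau t)) in
  (forall t, - taubar <= t -> 0 < x t) /\
  continuous_on (fun t => - taubar <= t) x /\
  (forall t, 0 < t -> is_derive x t (rhs t)) /\
  is_right_derive x 0 (rhs 0) /\
  (forall t, - taubar <= t <= 0 -> x t = psi t).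

(* The integral is oriented, so G is negative on (1, oo). *)
Definition G (g : R -> R) (x : R) : R := RInt (fun u => 1 / g u) x 1.

(* For F injective on D this determines Finv on the image F(D), and leaves it
   arbitrary elsewhere. *)
Definition is_inverse_on (D : R -> Prop) (F Finv : R -> R) : Prop :=
  forall x, D x -> Finv (F x) = x.

(* Main.v *)
Require Import Defs.
From Stdlib Require Import Reals Lra.
From Coquelicot Require Import Coquelicot.
Open Scope R_scope.

(** Along a solution the quantity [z t = G g (x t)] satisfies
    [z' = a - b * g (x (t - tau t)) / g (x t)], so everything reduces to showing
    that the quotient of the delayed and the current value of [g] tends to [1];
    then [z' -> a - b] and L'Hospital's rule gives [z t / t -> a - b].

    The link between [g] and [G] is regular variation: since
    [g (l * u) / g u -> l ^ beta], L'Hospital's rule gives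
    [G g (l * u) / G g u -> l ^ (1 - beta)] ([G_rv]), which needs that [G g] is
    unbounded at [0], a consequence of [beta > 1] ([G_p_infty]).  Hence, for [u]
    small, if [G g v] is not much less than [G g u], relatively speaking, then
    [v] cannot exceed [l * u] with [l] slightly above [1], and therefore [g v]
    cannot be much larger than [g u] ([G_comparison_controls_g]).

    The proof then has three steps.
    First, [z t >= c * t] for some [c > 0] ([G_solution_linear_growth]): if [z]
    touched the line [c * t] for the first time at [t], then
    [z (t - tau t) >= c * (t - tau t) >= (1 - eps) * z t], so the quotient of the
    values of [g] is close to [1] and [z'] at [t] is close to [a - b], which is
    more than the slope [c].
    Secondly, [z' <= a] gives [z t - z (t - tau t) <= a * tau t], and this is
    [o(t) = o(z t)] because of the linear growth ([delayed_G_close]); so the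
    upper limit of the quotient of the values of [g] is at most [1]
    ([delayed_g_upper]).
    Thirdly, [z] is now eventually nondecreasing, so [x] is eventually nonincreasing
    and the same quotient is at least [1] ([delayed_g_lower]).

    For the asymptotics of [x] itself, put [y t = Ginv t], so that
    [G g (x t) / G g (y t) = z t / t -> a - b].  As [G g] varies regularly with
    the nonzero exponent [1 - beta], such a limit can be inverted
    ([ratio_limit_from_G]): [x t / y t] tends to the number [L] with
    [L ^ (1 - beta) = a - b]. *)

(** * Calculus on half-lines *)

Lemma increment_le (f df : R -> R) (k s t : R) :
  s <= t ->
  (forall u, s <= u <= t -> is_derive f u (df u)) ->
  (forall u, s <= u <= t -> df u <= k) ->
  f t - f s <= k * (t - s).
Proof.
  intros Hst Hd Hk.
  destruct (MVT_gen f s t df) as [c [Hc Heq]];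
    rewrite ?Rmin_left, ?Rmax_right in * by lra.
  - intros u Hu. apply Hd. lra.
  - intros u Hu. apply derivable_continuous_pt.
    exists (df u). apply is_derive_Reals, Hd, Hu.
  - rewrite Heq. apply Rmult_le_compat_r; [lra | now apply Hk].
Qed.

Lemma increment_ge (f df : R -> R) (k s t : R) :
  s <= t ->
  (forall u, s <= u <= t -> is_derive f u (df u)) ->
  (forall u, s <= u <= t -> k <= df u) ->
  k * (t - s) <= f t - f s.
Proof.
  intros Hst Hd Hk.
  cut (- f t - - f s <= - k * (t - s)); [lra |].
  apply (increment_le (fun u => - f u) (fun u => - df u)); [exact Hst | |].
  - intros u Hu. apply (is_derive_opp f), Hd, Hu.
  - intros u Hu. specialize (Hk u Hu). lra.
Qed.

Lemma filterlim_eventually_between (T : Type) (F : (T -> Prop) -> Prop)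
  {FF : Filter F} (f : T -> R) (l lo hi : R) :
  filterlim f F (locally l) -> lo < l < hi -> F (fun t => lo < f t < hi).
Proof.
  intros Hf Hl. apply (Hf (fun r => lo < r < hi)).
  apply (locally_interval _ l lo hi); simpl; tauto.
Qed.

Lemma filterlim_locally_between (T : Type) (F : (T -> Prop) -> Prop)
  {FF : Filter F} (f : T -> R) (l : R) :
  (forall eps, 0 < eps -> F (fun t => l - eps <= f t <= l + eps)) ->
  filterlim f F (locally l).
Proof.
  intros H. apply filterlim_locally. intros eps.
  pose proof (cond_pos eps) as Heps.
  apply (filter_imp (fun t => l - eps / 2 <= f t <= l + eps / 2)); [| apply H; lra].
  intros t Ht. apply Rabs_def1; unfold minus, plus, opp; simpl; lra.
Qed.

Lemma at_right_0_interval (eps : R) :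
  0 < eps -> at_right 0 (fun u => 0 < u < eps).
Proof.
  intros He. exists (mkposreal eps He). intros u Hu Hu0.
  apply Rabs_def2 in Hu. unfold minus, plus, opp in Hu; simpl in Hu. lra.
Qed.

Lemma at_right_0_inv (P : R -> Prop) :
  at_right 0 P -> exists eps, 0 < eps /\ forall u, 0 < u < eps -> P u.
Proof.
  intros [eps H]. exists eps. split; [apply cond_pos |].
  intros u Hu. apply H; [| lra].
  apply Rabs_def1; unfold minus, plus, opp; simpl; lra.
Qed.

Lemma filterlim_Rinv_p_infty_at_right :
  filterlim Rinv (Rbar_locally p_infty) (at_right 0).
Proof.
  intros P HP. apply at_right_0_inv in HP. destruct HP as [eps [He HP]].
  exists (/ eps). intros t Ht. apply HP.
  pose proof (Rinv_0_lt_compat _ He). split.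
  - apply Rinv_0_lt_compat. lra.
  - rewrite <- (Rinv_inv eps). apply Rinv_lt_contravar; [| lra].
    apply Rmult_lt_0_compat; lra.
Qed.

(** One half of L'Hospital's rule: [f - L * h] has a nonpositive derivative far
    out, hence is bounded above by a constant, which [eps * h] absorbs because
    [h] tends to infinity. *)
Lemma lhospital_upper (f h df dh : R -> R) (L eps : R) :
  0 < eps ->
  Rbar_locally p_infty (fun t => is_derive f t (df t)) ->
  Rbar_locally p_infty (fun t => is_derive h t (dh t)) ->
  filterlim h (Rbar_locally p_infty) (Rbar_locally p_infty) ->
  Rbar_locally p_infty (fun t => df t <= L * dh t) ->
  Rbar_locally p_infty (fun t => f t / h t <= L + eps).
Proof.
  intros Heps Hf Hh Hinf Hle.
  destruct (filter_and _ _ (filter_and _ _ Hf Hh) Hle) as [M HM].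
  set (C := f (M + 1) - L * h (M + 1)).
  assert (HC : forall t, M + 1 <= t -> f t <= L * h t + C).
  { intros t Ht.
    cut ((f t - L * h t) - (f (M + 1) - L * h (M + 1)) <= 0 * (t - (M + 1)));
      [unfold C; lra |].
    apply (increment_le (fun u => f u - L * h u) (fun u => df u - L * dh u));
      [exact Ht | |].
    - intros u Hu. destruct (HM u) as [[H1 H2] _]; [lra |].
      apply (is_derive_minus f (fun v => L * h v)); [exact H1 |].
      now apply is_derive_scal.
    - intros u Hu. destruct (HM u) as [_ H]; lra. }
  assert (Hbig : Rbar_locally p_infty (fun t => Rabs C / eps < h t)).
  { apply Hinf. now exists (Rabs C / eps). }
  assert (Hlarge : Rbar_locally p_infty (fun t => M + 1 < t)) by now exists (M + 1).
  apply (filter_imp _ _) with (2 := filter_and _ _ Hbig Hlarge).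
  intros t [Ht1 Ht2].
  assert (0 <= Rabs C / eps).
  { apply Rmult_le_pos; [apply Rabs_pos |].
    apply Rlt_le, Rinv_0_lt_compat, Heps. }
  apply Rle_div_l; [lra |].
  apply Rlt_div_l in Ht1; [| lra].
  pose proof (Rle_abs C). specialize (HC t ltac:(lra)). lra.
Qed.

(** The form of L'Hospital's rule in which only the denominator is required to
    tend to infinity. *)
Lemma lhospital_p_infty (f h df dh : R -> R) (L : R) :
  Rbar_locally p_infty (fun t => is_derive f t (df t)) ->
  Rbar_locally p_infty (fun t => is_derive h t (dh t)) ->
  Rbar_locally p_infty (fun t => 0 < dh t) ->
  filterlim h (Rbar_locally p_infty) (Rbar_locally p_infty) ->
  filterlim (fun t => df t / dh t) (Rbar_locally p_infty) (locally L) ->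
  filterlim (fun t => f t / h t) (Rbar_locally p_infty) (locally L).
Proof.
  intros Hf Hh Hpos Hinf Hlim.
  apply (filterlim_locally_between R (Rbar_locally p_infty)). intros eps Heps.
  assert (Hq := filterlim_eventually_between _ _ _ _ (L - eps / 2) (L + eps / 2)
                  Hlim ltac:(lra)).
  assert (Hb := filter_and _ _ Hq Hpos).
  assert (Hup : Rbar_locally p_infty
                  (fun t => f t / h t <= L + eps / 2 + eps / 2)).
  { apply (lhospital_upper f h df dh); [lra | exact Hf | exact Hh | exact Hinf |].
    revert Hb. apply filter_imp. intros t [H1 H2].
    apply Rle_div_l; [lra |]. lra. }
  assert (Hlo : Rbar_locally p_infty
                  (fun t => - f t / h t <= - (L - eps / 2) + eps / 2)).
  { apply (lhospital_upper (fun t => - f t) h (fun t => - df t) dh);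
      [lra | | exact Hh | exact Hinf |].
    - revert Hf. apply filter_imp. intros t H. now apply (is_derive_opp f).
    - revert Hb. apply filter_imp. intros t [H1 H2].
      cut ((L - eps / 2) * dh t <= df t); [lra |].
      apply Rle_div_r; [lra |]. lra. }
  generalize (filter_and _ _ Hup Hlo). apply filter_imp.
  intros t [H1 H2]. unfold Rdiv in *. rewrite <- Ropp_mult_distr_l in H2. lra.
Qed.

(** The comparison principle for delay equations: the sign of the derivative
    at a first zero may depend on the whole past of [h], so the third hypothesis
    may assume that [h] has been nonnegative up to that zero. *)
Lemma no_first_zero (h dh : R -> R) (T0 T1 : R) :
  (forall s, T0 <= s <= T1 -> 0 < h s) ->
  (forall t, T1 <= t -> is_derive h t (dh t)) ->
  (forall t, T1 < t -> (forall s, T0 <= s <= t -> 0 <= h s) -> h t = 0 ->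
     0 < dh t) ->
  T0 <= T1 ->
  forall t, T1 <= t -> 0 < h t.
Proof.
  intros Hinit Hd Hzero HT t1 Ht1.
  destruct (Rlt_le_dec 0 (h t1)) as [| Hneg]; [assumption | exfalso].
  (* [m] is the first zero: [h] is positive before it, so [h m < 0] contradicts
     continuity, [h m = 0] contradicts the sign of the derivative, and
     [0 < h m] contradicts maximality. *)
  set (E := fun t => T1 <= t <= t1 /\ forall s, T0 <= s <= t -> 0 < h s).
  destruct (completeness E) as [m [Hub Hlub]].
  { exists t1. intros t [Ht _]. lra. }
  { exists T1. split; [lra | exact Hinit]. }
  assert (Hm1 : T1 <= m) by (apply Hub; split; [lra | exact Hinit]).
  assert (Hm2 : m <= t1) by (apply Hlub; intros t [Ht _]; lra).
  assert (Hbefore : forall s, T0 <= s < m -> 0 < h s).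
  { intros s Hs. destruct (Rlt_le_dec 0 (h s)) as [| Hn]; [assumption | exfalso].
    cut (m <= s); [lra |]. apply Hlub. intros t [Ht Hpos].
    destruct (Rle_lt_dec t s) as [| Hlt]; [assumption |].
    specialize (Hpos s ltac:(lra)). lra. }
  assert (Hcont : forall eps, 0 < eps -> exists d, 0 < d /\
            forall s, Rabs (s - m) < d -> Rabs (h s - h m) < eps).
  { intros eps Heps.
    assert (Hc : continuous h m).
    { apply (@ex_derive_continuous R_AbsRing R_NormedModule). now exists (dh m); apply Hd. }
    apply filterlim_locally with (eps := mkposreal eps Heps) in Hc.
    destruct Hc as [d Hc]. exists d. split; [apply cond_pos |].
    intros s Hs. now apply Hc. }
  destruct (Rtotal_order (h m) 0) as [Hlt | [Heq | Hgt]].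
  - destruct (Rle_lt_or_eq_dec _ _ Hm1) as [Hm | Hm];
      [| subst m; specialize (Hinit T1 ltac:(lra)); lra].
    destruct (Hcont (- h m)) as [d [Hd0 Hs]]; [lra |].
    set (s := Rmax T1 (m - d / 2)).
    assert (Hs1 : T1 <= s < m) by (split; [apply Rmax_l | apply Rmax_lub_lt; lra]).
    assert (m - d / 2 <= s) by apply Rmax_r.
    specialize (Hbefore s ltac:(lra)).
    specialize (Hs s ltac:(apply Rabs_def1; lra)). apply Rabs_def2 in Hs. lra.
  - destruct (Rle_lt_or_eq_dec _ _ Hm1) as [Hm | Hm];
      [| subst m; specialize (Hinit T1 ltac:(lra)); lra].
    assert (Hpos : 0 < dh m).
    { apply Hzero; [exact Hm | | exact Heq].
      intros s Hs. destruct (Req_dec s m) as [-> |]; [lra |].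
      apply Rlt_le, Hbefore. lra. }
    specialize (Hd m Hm1). apply is_derive_Reals in Hd.
    destruct (Hd (dh m) Hpos) as [d Hq].
    pose proof (cond_pos d) as Hd0.
    set (k := Rmin (d / 2) (m - T1)).
    assert (Hk : 0 < k) by (apply Rmin_glb_lt; lra).
    assert (k <= d / 2) by apply Rmin_l. assert (k <= m - T1) by apply Rmin_r.
    specialize (Hq (- k) ltac:(lra) ltac:(rewrite Rabs_Ropp, Rabs_pos_eq; lra)).
    specialize (Hbefore (m + - k) ltac:(lra)).
    apply Rabs_def2 in Hq. destruct Hq as [_ Hq].
    assert (Hq' : 0 < (h (m + - k) - h m) / - k) by lra.
    rewrite Heq, Rminus_0_r in Hq'.
    replace (h (m + - k) / - k) with (- (h (m + - k) / k)) in Hq' by (field; lra).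
    assert (0 < h (m + - k) / k) by (apply Rdiv_lt_0_compat; lra). lra.
  - destruct (Hcont (h m) Hgt) as [d [Hd0 Hs]].
    assert (Hmlt : m < t1) by (destruct (Req_dec m t1) as [-> |]; lra).
    set (s := Rmin t1 (m + d / 2)).
    assert (Hs1 : m < s <= t1) by (split; [apply Rmin_glb_lt; lra | apply Rmin_l]).
    assert (Hs2 : s <= m + d / 2) by apply Rmin_r.
    cut (s <= m); [lra |]. apply Hub. split; [lra |].
    intros u Hu. destruct (Rlt_le_dec u m) as [Hum | Hum]; [apply Hbefore; lra |].
    specialize (Hs u ltac:(apply Rabs_def1; lra)). apply Rabs_def2 in Hs. lra.
Qed.

(** * The primitive [G] of a regularly varying nonlinearity *)

Record regular_nonlinearity (beta : R) (g : R -> R) : Prop := {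
  exponent_gt_1 : 1 < beta;
  nonlinearity_continuous : forall u, 0 < u -> continuous g u;
  nonlinearity_pos : forall u, 0 < u -> 0 < g u;
  nonlinearity_incr : exists d, 0 < d /\
    forall u v, 0 < u -> u <= v -> v < d -> g u <= g v;
  nonlinearity_rv : forall l, 0 < l ->
    filterlim (fun u => g (l * u) / g u) (at_right 0) (locally (Rpower l beta))
}.

Lemma Rpower_decr_base (p k l : R) :
  p < 0 -> 0 < k < l -> Rpower l p < Rpower k p.
Proof.
  intros Hp Hkl. replace p with (- - p) by ring. rewrite !(Rpower_Ropp _ (- p)).
  assert (forall r, 0 < Rpower r (- p)) by (intros; apply exp_pos).
  apply Rinv_lt_contravar; [now apply Rmult_lt_0_compat |].
  apply Rlt_Rpower_l; lra.
Qed.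

Lemma G_derive (beta : R) (g : R -> R) (u : R) :
  regular_nonlinearity beta g -> 0 < u -> is_derive (G g) u (- / g u).
Proof.
  intros Hg Hu.
  assert (Hc : forall v, 0 < v -> continuous (fun v => 1 / g v) v).
  { intros v Hv. unfold Rdiv.
    apply (@continuous_mult R_UniformSpace R_AbsRing (fun _ => 1) (fun v => / g v));
      [apply continuous_const |].
    apply continuous_Rinv_comp; [now apply (nonlinearity_continuous _ _ Hg) |].
    pose proof (nonlinearity_pos _ _ Hg v Hv). lra. }
  evar_last.
  - apply (is_derive_RInt' (fun v => 1 / g v) (G g) u 1); [| now apply Hc].
    apply (locally_interval _ u 0 p_infty); [exact Hu | exact I |].
    intros v Hv _. simpl in Hv. apply (RInt_correct (V := R_CompleteNormedModule)).
    apply (ex_RInt_continuous (V := R_CompleteNormedModule)).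
    intros w [Hw _]. apply Hc.
    eapply Rlt_le_trans; [| exact Hw]. apply Rmin_glb_lt; lra.
  - unfold opp; simpl. unfold Rdiv. ring.
Qed.

Lemma G_decr (beta : R) (g : R -> R) (u v : R) :
  regular_nonlinearity beta g -> 0 < u < v -> G g v < G g u.
Proof.
  intros Hg Huv. cut (- G g u < - G g v); [lra |].
  apply (incr_function (fun w => - G g w) 0 p_infty (fun w => / g w));
    try exact I; try (simpl; lra).
  - intros w Hw _. simpl in Hw. evar_last.
    + apply (is_derive_opp (G g)), (G_derive beta); assumption.
    + unfold opp; simpl. ring.
  - intros w Hw _. now apply Rinv_0_lt_compat, (nonlinearity_pos _ _ Hg).
Qed.

Lemma G_lt_cancel (beta : R) (g : R -> R) (u v : R) :
  regular_nonlinearity beta g -> 0 < v -> G g v < G g u -> u < v.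
Proof.
  intros Hg Hv H. destruct (Rtotal_order u v) as [| [-> | Hlt]]; [assumption | lra |].
  assert (H1 := G_decr beta g v u Hg ltac:(lra)). lra.
Qed.

Lemma G_le_cancel (beta : R) (g : R -> R) (u v : R) :
  regular_nonlinearity beta g -> 0 < v -> G g v <= G g u -> u <= v.
Proof.
  intros Hg Hv H. destruct (Rle_lt_dec u v) as [| Hlt]; [assumption |].
  assert (H1 := G_decr beta g v u Hg ltac:(lra)). lra.
Qed.

(** The increment [G g u - G g (2 * u)] does not decrease as [u] decreases to
    [0], because its derivative is [2 / g (2 * u) - 1 / g u] and
    [g (2 * u) / g u -> 2 ^ beta > 2].  So each halving of [u] adds at least a
    fixed amount [m] to [G g]. *)
Lemma G_p_infty (beta : R) (g : R -> R) :
  regular_nonlinearity beta g ->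
  filterlim (G g) (at_right 0) (Rbar_locally p_infty).
Proof.
  intros Hg. pose proof (exponent_gt_1 _ _ Hg) as Hbeta.
  assert (H2 : 2 < Rpower 2 beta).
  { rewrite <- (Rpower_1 2) at 1 by lra. apply Rpower_lt; lra. }
  assert (Hev : at_right 0 (fun u => 2 < g (2 * u) / g u)).
  { generalize (filterlim_eventually_between R (at_right 0) _ _ 2 (Rpower 2 beta + 1)
      (nonlinearity_rv _ _ Hg 2 ltac:(lra)) ltac:(lra)).
    apply filter_imp. intros u Hu. tauto. }
  apply at_right_0_inv in Hev. destruct Hev as [eta [Heta Hev]].
  set (e := eta / 2).
  set (m := G g e - G g (2 * e)).
  assert (Hm : 0 < m).
  { assert (H := G_decr beta g e (2 * e) Hg ltac:(unfold e; lra)). unfold m. lra. }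
  assert (Hstep : forall u, 0 < u <= e -> G g (2 * u) + m <= G g u).
  { intros u Hu.
    cut ((G g e - G g (2 * e)) - (G g u - G g (2 * u)) <= 0 * (e - u));
      [unfold m; lra |].
    apply (increment_le (fun v => G g v - G g (2 * v))
             (fun v => - / g v - 2 * - / g (2 * v))); [lra | |].
    - intros v Hv.
      apply (is_derive_minus (G g) (fun v => G g (2 * v)));
        [apply (G_derive beta); [assumption | lra] |].
      apply (is_derive_comp (G g) (fun v => 2 * v));
        [apply (G_derive beta); [assumption | lra] |].
      auto_derive; [exact I | ring].
    - intros v Hv. specialize (Hev v ltac:(unfold e in Hv; lra)).
      pose proof (nonlinearity_pos _ _ Hg v ltac:(lra)) as Hp.
      pose proof (nonlinearity_pos _ _ Hg (2 * v) ltac:(lra)) as Hp2.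
      apply Rlt_div_r in Hev; [| exact Hp].
      cut (2 * / g (2 * v) <= / g v); [lra |].
      replace (2 * / g (2 * v)) with (/ (g (2 * v) / 2)) by (field; lra).
      apply Rinv_le_contravar; lra. }
  assert (Hiter : forall n, exists u, 0 < u <= e /\ G g e + INR n * m <= G g u).
  { induction n as [| n [u [Hu HG]]].
    - exists e. simpl. unfold e. split; lra.
    - exists (u / 2). split; [lra |].
      specialize (Hstep (u / 2) ltac:(lra)).
      replace (2 * (u / 2)) with u in Hstep by field.
      rewrite S_INR. lra. }
  intros P [M HP].
  destruct (INR_unbounded ((M - G g e) / m)) as [n Hn].
  apply Rgt_lt, Rlt_div_l in Hn; [| lra].
  destruct (Hiter n) as [u [Hu HG]].
  unfold filtermap.
  generalize (at_right_0_interval u ltac:(lra)). apply filter_imp.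
  intros v Hv. apply HP. assert (H := G_decr beta g v u Hg ltac:(lra)). lra.
Qed.

Lemma G_onto (beta : R) (g : R -> R) (t : R) :
  regular_nonlinearity beta g -> 0 < t -> exists u, 0 < u /\ G g u = t.
Proof.
  intros Hg Ht.
  assert (H1 : G g 1 = 0) by apply (RInt_point (V := R_CompleteNormedModule)).
  assert (Hlarge : at_right 0 (fun u => t < G g u)).
  { apply (G_p_infty beta g Hg (fun r => _ < r)). now exists t. }
  apply at_right_0_inv in Hlarge. destruct Hlarge as [e [He Hlarge]].
  specialize (Hlarge (e / 2) ltac:(lra)).
  assert (Hlt : e / 2 < 1) by (apply (G_lt_cancel beta g); [assumption | lra | lra]).
  destruct (Ranalysis5.IVT_interv (fun u => t - G g u) (e / 2) 1) as [u [Hu Hroot]];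
    [| lra | lra | lra |].
  - intros u Hu. apply derivable_continuous_pt. exists (0 - - / g u).
    apply is_derive_Reals.
    apply (is_derive_minus (fun _ => t) (G g)); [apply (@is_derive_const R_AbsRing R_NormedModule) |].
    apply (G_derive beta); [assumption | lra].
  - exists u. lra.
Qed.

(** In the variable [s = 1 / u] the quotient of the derivatives is
    [l / (g (l / s) / g (1 / s))], whose limit is [l / l ^ beta]. *)
Lemma G_rv (beta : R) (g : R -> R) (l : R) :
  regular_nonlinearity beta g -> 0 < l ->
  filterlim (fun u => G g (l * u) / G g u) (at_right 0)
    (locally (Rpower l (1 - beta))).
Proof.
  intros Hg Hl.
  set (p := Rpower l beta). assert (Hp : 0 < p) by apply exp_pos.
  assert (Hpos : Rbar_locally p_infty (fun s => 0 < s)) by now exists 0.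
  assert (Hderiv : forall k s, 0 < k -> 0 < s ->
    is_derive (fun s => G g (k * / s)) s (k / (s ^ 2 * g (k * / s)))).
  { intros k s Hk Hs.
    pose proof (Rinv_0_lt_compat s Hs) as Hs'.
    assert (Hks : 0 < k * / s) by now apply Rmult_lt_0_compat.
    pose proof (nonlinearity_pos _ _ Hg _ Hks).
    evar_last.
    - apply (is_derive_comp (G g) (fun s => k * / s) s (- / g (k * / s)) (- k / s ^ 2)).
      + now apply (G_derive beta).
      + auto_derive; [lra | field; lra].
    - unfold scal; simpl; unfold mult; simpl. field. lra. }
  apply (filterlim_ext (fun u => G g (l * / / u) / G g (1 * / / u))).
  { intros u. now rewrite Rinv_inv, Rmult_1_l. }
  apply (filterlim_comp _ _ _ Rinv
           (fun s => G g (l * / s) / G g (1 * / s)) _ (Rbar_locally p_infty));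
    [exact filterlim_Rinv_0_right |].
  apply (lhospital_p_infty _ _ (fun s => l / (s ^ 2 * g (l * / s)))
                               (fun s => 1 / (s ^ 2 * g (1 * / s)))).
  - revert Hpos. apply filter_imp. intros s Hs. now apply Hderiv.
  - revert Hpos. apply filter_imp. intros s Hs. apply Hderiv; lra.
  - revert Hpos. apply filter_imp. intros s Hs.
    apply Rdiv_lt_0_compat, Rmult_lt_0_compat; [lra | now apply pow_lt |].
    rewrite Rmult_1_l. now apply (nonlinearity_pos _ _ Hg), Rinv_0_lt_compat.
  - apply (filterlim_ext (fun s => G g (/ s))); [intros s; now rewrite Rmult_1_l |].
    apply (filterlim_comp _ _ _ Rinv (G g) _ (at_right 0));
      [exact filterlim_Rinv_p_infty_at_right | exact (G_p_infty beta g Hg)].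
  - apply (filterlim_ext_loc (fun s => l * / (g (l * / s) / g (/ s)))).
    { revert Hpos. apply filter_imp. intros s Hs.
      pose proof (Rinv_0_lt_compat s Hs) as Hs'.
      pose proof (nonlinearity_pos _ _ Hg _ Hs').
      pose proof (nonlinearity_pos _ _ Hg _ (Rmult_lt_0_compat _ _ Hl Hs')).
      rewrite Rmult_1_l. field. lra. }
    replace (Rpower l (1 - beta)) with (l * / p).
    2:{ unfold Rminus. rewrite Rpower_plus, Rpower_Ropp, Rpower_1 by exact Hl.
        reflexivity. }
    apply (filterlim_comp _ _ _ (fun s => g (l * / s) / g (/ s)) (fun r => l * / r)
             _ (locally p)).
    + apply (filterlim_comp _ _ _ Rinv (fun u => g (l * u) / g u) _ (at_right 0));
        [exact filterlim_Rinv_p_infty_at_right |].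
      now apply (nonlinearity_rv _ _ Hg).
    + apply (@ex_derive_continuous R_AbsRing R_NormedModule (fun r => l * / r)).
      auto_derive. lra.
Qed.

(** Closeness of [G g v] to [G g u] from below passes to [g].  Choose [l > 1] with
    [l ^ beta < rho].  As [G g (l * u) / G g u] tends to [l ^ (1 - beta) < 1],
    the hypothesis on [G g v] forces [v < l * u] when [u] is small, and then
    [g v <= g (l * u) <= rho * g u] since [g] increases near [0]. *)
Lemma G_comparison_controls_g (beta : R) (g : R -> R) (rho : R) :
  regular_nonlinearity beta g -> 1 < rho ->
  exists eps eta, 0 < eps /\ 0 < eta /\
    forall u v, 0 < u < eta -> 0 < v -> (1 - eps) * G g u <= G g v ->
      g v <= rho * g u.
Proof.
  intros Hg Hrho. pose proof (exponent_gt_1 _ _ Hg) as Hbeta.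
  (* [m] is any number strictly between [1] and [rho], and [l ^ beta = m]. *)
  set (m := (1 + rho) / 2). assert (Hm : 1 < m < rho) by (unfold m; lra).
  set (l := Rpower m (/ beta)).
  assert (Hl : 1 < l).
  { unfold l. rewrite <- (Rpower_O m) at 1 by lra.
    apply Rpower_lt; [lra | apply Rinv_0_lt_compat; lra]. }
  assert (Hlm : Rpower l beta = m).
  { unfold l. rewrite Rpower_mult, Rinv_l by lra. apply Rpower_1. lra. }
  set (p := Rpower l (1 - beta)).
  assert (Hp : p < 1).
  { unfold p. rewrite <- (Rpower_O l) at 2 by lra. apply Rpower_lt; lra. }
  destruct (nonlinearity_incr _ _ Hg) as [d [Hd Hincr]].
  assert (Hrv := filterlim_eventually_between R (at_right 0) _ _ (m - 1) rho
    (nonlinearity_rv _ _ Hg l ltac:(lra)) ltac:(lra)).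
  assert (HGrv := filterlim_eventually_between R (at_right 0) _ _ (p - 1) ((1 + p) / 2)
    (G_rv beta g l Hg ltac:(lra)) ltac:(fold p; lra)).
  assert (HGpos : at_right 0 (fun u => 0 < G g u)).
  { apply (G_p_infty beta g Hg (fun r => _ < r)). now exists 0. }
  assert (Hsmall := at_right_0_interval (d / l) ltac:(apply Rdiv_lt_0_compat; lra)).
  destruct (at_right_0_inv _ (filter_and _ _ (filter_and _ _ Hrv HGrv)
                                (filter_and _ _ HGpos Hsmall))) as [eta [Heta Hall]].
  exists ((1 - p) / 2), eta. split; [lra |]. split; [exact Heta |].
  intros u v Hu Hv HG.
  destruct (Hall u Hu) as [[[_ H1] [_ H2]] [H3 [_ H4]]].
  apply Rlt_div_l in H1; [| now apply (nonlinearity_pos _ _ Hg)].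
  apply (proj1 (Rlt_div_l _ _ _ H3)) in H2.
  apply (proj2 (Rlt_div_r _ _ l ltac:(lra))) in H4.
  assert (Hvl : v < l * u).
  { apply (G_lt_cancel beta g); [assumption | apply Rmult_lt_0_compat; lra |].
    replace (1 - (1 - p) / 2) with ((1 + p) / 2) in HG by field. lra. }
  apply Rle_trans with (g (l * u)); [apply Hincr; lra | lra].
Qed.

(** For [k > L] the quotient [G g (k * v) / G g v] tends to
    [k ^ (1 - beta) < L ^ (1 - beta)], so eventually [G g (k * v) < G g u], that
    is [u < k * v]; symmetrically for [k < L]. *)
Lemma ratio_limit_from_G (beta : R) (g : R -> R) (T : Type)
  (F : (T -> Prop) -> Prop) (FF : Filter F) (u v : T -> R) (L : R) :
  regular_nonlinearity beta g -> 0 < L ->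
  F (fun t => 0 < u t) ->
  filterlim v F (at_right 0) ->
  filterlim (fun t => G g (u t) / G g (v t)) F (locally (Rpower L (1 - beta))) ->
  filterlim (fun t => u t / v t) F (locally L).
Proof.
  intros Hg HL Hu Hv Hlim. pose proof (exponent_gt_1 _ _ Hg) as Hbeta.
  assert (Hvpos : F (fun t => 0 < v t)).
  { apply (Hv (fun r => 0 < r)). generalize (at_right_0_interval 1 ltac:(lra)).
    apply filter_imp. tauto. }
  assert (HGv : F (fun t => 0 < G g (v t))).
  { apply (Hv (fun r => 0 < G g r)), (G_p_infty beta g Hg (fun r => _ < r)). now exists 0. }
  assert (Hscaled : forall k, 0 < k ->
    filterlim (fun t => G g (k * v t) / G g (v t)) F (locally (Rpower k (1 - beta)))).
  { intros k Hk.
    apply (filterlim_comp _ _ _ v (fun r => G g (k * r) / G g r) _ (at_right 0));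
      [exact Hv | now apply G_rv]. }
  assert (Hpos := filter_and _ _ Hu (filter_and _ _ Hvpos HGv)).
  assert (Hup : forall k, L < k -> F (fun t => u t / v t <= k)).
  { intros k Hk.
    assert (Hlt := Rpower_decr_base (1 - beta) L k ltac:(lra) ltac:(lra)).
    set (A := Rpower L (1 - beta)) in *. set (B := Rpower k (1 - beta)) in *.
    assert (H1 := filterlim_eventually_between T F _ _ ((A + B) / 2) (A + 1)
                    Hlim ltac:(fold A; lra)).
    assert (H2 := filterlim_eventually_between T F _ _ (B - 1) ((A + B) / 2)
                    (Hscaled k ltac:(lra)) ltac:(fold B; lra)).
    generalize (filter_and _ _ Hpos (filter_and _ _ H1 H2)). apply filter_imp.
    intros t [[Hut [Hvt HGt]] [[H3 _] [_ H4]]].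
    apply (proj2 (Rlt_div_r _ _ _ HGt)) in H3. apply (proj1 (Rlt_div_l _ _ _ HGt)) in H4.
    apply Rle_div_l; [exact Hvt |].
    apply Rlt_le, (G_lt_cancel beta g); [assumption | | lra].
    apply Rmult_lt_0_compat; lra. }
  assert (Hlo : forall k, 0 < k < L -> F (fun t => k <= u t / v t)).
  { intros k Hk.
    assert (Hlt := Rpower_decr_base (1 - beta) k L ltac:(lra) ltac:(lra)).
    set (A := Rpower L (1 - beta)) in *. set (B := Rpower k (1 - beta)) in *.
    assert (H1 := filterlim_eventually_between T F _ _ (A - 1) ((A + B) / 2)
                    Hlim ltac:(fold A; lra)).
    assert (H2 := filterlim_eventually_between T F _ _ ((A + B) / 2) (B + 1)
                    (Hscaled k ltac:(lra)) ltac:(fold B; lra)).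
    generalize (filter_and _ _ Hpos (filter_and _ _ H1 H2)). apply filter_imp.
    intros t [[Hut [Hvt HGt]] [[_ H3] [H4 _]]].
    apply (proj1 (Rlt_div_l _ _ _ HGt)) in H3. apply (proj2 (Rlt_div_r _ _ _ HGt)) in H4.
    apply Rle_div_r; [exact Hvt |].
    apply Rlt_le, (G_lt_cancel beta g); [assumption | exact Hut | lra]. }
  apply (filterlim_locally_between T F). intros eps Heps.
  assert (Hk : 0 < Rmax (L - eps) (L / 2) < L).
  { split; [| apply Rmax_lub_lt; lra].
    apply Rlt_le_trans with (L / 2); [lra | apply Rmax_r]. }
  generalize (@filter_and T F FF _ _ (Hup (L + eps) ltac:(lra)) (Hlo _ Hk)). apply filter_imp.
  intros t [H1 H2]. pose proof (Rmax_l (L - eps) (L / 2)). lra.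
Qed.

(** * Decaying solutions of the delay equation *)

(** Every clause is an eventual one, so that facts combine by intersecting
    neighbourhoods of infinity and pass to the delayed time [t - tau t] by
    composition with the limit [delayed_time_p_infty]. *)
Record decaying_solution (g : R -> R) (a b : R) (tau x : R -> R) : Prop := {
  solution_pos : Rbar_locally p_infty (fun t => 0 < x t);
  solution_derive : Rbar_locally p_infty (fun t =>
    is_derive x t (- a * g (x t) + b * g (x (t - tau t))));
  solution_decay : filterlim x (Rbar_locally p_infty) (locally 0);
  delay_nonneg : Rbar_locally p_infty (fun t => 0 <= tau t);
  delayed_time_p_infty :
    filterlim (fun t => t - tau t) (Rbar_locally p_infty) (Rbar_locally p_infty);
  delay_sublinear :
    filterlim (fun t => tau t / t) (Rbar_locally p_infty) (locally 0)
}.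

Lemma solution_at_right (g : R -> R) (a b : R) (tau x : R -> R) :
  decaying_solution g a b tau x ->
  filterlim x (Rbar_locally p_infty) (at_right 0).
Proof.
  intros Hx P HP. unfold filtermap.
  generalize (filter_and _ _ (solution_pos _ _ _ _ _ Hx)
                (solution_decay _ _ _ _ _ Hx _ HP)).
  apply filter_imp. intros t [Hpos H]. exact (H Hpos).
Qed.

Lemma delay_eventually_small (g : R -> R) (a b : R) (tau x : R -> R) (eps : R) :
  decaying_solution g a b tau x -> 0 < eps ->
  Rbar_locally p_infty (fun t => 0 < t /\ tau t <= eps * t).
Proof.
  intros Hx Heps.
  assert (Hq := filterlim_eventually_between R (Rbar_locally p_infty) _ _ (- eps) eps
                  (delay_sublinear _ _ _ _ _ Hx) ltac:(lra)).
  assert (Hpos : Rbar_locally p_infty (fun t => 0 < t)) by now exists 0.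
  generalize (filter_and _ _ Hpos Hq). apply filter_imp.
  intros t [Ht [_ H]]. split; [exact Ht |].
  apply (proj1 (Rlt_div_l _ _ _ Ht)) in H. lra.
Qed.

Lemma G_solution_derive (beta : R) (g : R -> R) (a b : R) (tau x : R -> R) :
  regular_nonlinearity beta g -> decaying_solution g a b tau x ->
  Rbar_locally p_infty (fun t =>
    is_derive (fun s => G g (x s)) t (a - b * (g (x (t - tau t)) / g (x t)))).
Proof.
  intros Hg Hx.
  generalize (filter_and _ _ (solution_pos _ _ _ _ _ Hx) (solution_derive _ _ _ _ _ Hx)).
  apply filter_imp. intros t [Hpos Hd].
  pose proof (nonlinearity_pos _ _ Hg _ Hpos).
  evar_last.
  - apply (is_derive_comp (G g) x); [now apply (G_derive beta) | exact Hd].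
  - unfold scal; simpl; unfold mult; simpl. field. lra.
Qed.

(** [G g (x t)] stays above the line [c * t].  The slope is chosen last: the
    comparison holds for arguments below a threshold [eta] that does not depend
    on [c], so one first waits until [x] is below [eta] and [G g (x t) > 1],
    and then takes [c] so small that the line is at most [1] over the whole
    history interval. *)
Lemma G_solution_linear_growth (beta : R) (g : R -> R) (a b : R) (tau x : R -> R) :
  regular_nonlinearity beta g -> decaying_solution g a b tau x -> 0 < b < a ->
  exists c, 0 < c /\ Rbar_locally p_infty (fun t => c * t <= G g (x t)).
Proof.
  intros Hg Hx Hab.
  (* With this [rho] a quotient of at most [rho] gives a derivative of at least
     [(a - b) / 2], twice the largest slope admitted below. *)
  set (rho := (1 + a / b) / 2).
  assert (Hbrho : b * rho = (a + b) / 2) by (unfold rho; field; lra).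
  assert (Hrho : 1 < rho).
  { apply Rmult_lt_reg_l with b; lra. }
  destruct (G_comparison_controls_g beta g rho Hg Hrho) as [eps [eta [Heps [Heta Hcmp]]]].
  assert (Hsmall : Rbar_locally p_infty (fun t => 0 < x t < eta)).
  { exact (solution_at_right _ _ _ _ _ Hx _ (at_right_0_interval eta Heta)). }
  assert (HGbig : Rbar_locally p_infty (fun t => 1 < G g (x t))).
  { apply (filterlim_comp _ _ _ x (G g) _ _ _ (solution_at_right _ _ _ _ _ Hx)
             (G_p_infty beta g Hg) (fun r => 1 < r)). now exists 1. }
  destruct (filter_and _ _ Hsmall HGbig) as [M0 HM0].
  assert (Hback : Rbar_locally p_infty (fun t => M0 + 1 < t - tau t)).
  { apply (delayed_time_p_infty _ _ _ _ _ Hx (fun r => M0 + 1 < r)). now exists (M0 + 1). }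
  destruct (filter_and _ _ (filter_and _ _ Hback (delay_nonneg _ _ _ _ _ Hx))
             (filter_and _ _ (delay_eventually_small _ _ _ _ _ eps Hx Heps)
                (G_solution_derive beta g a b tau x Hg Hx))) as [M1 HM1].
  (* From [T1] on, delayed times are later than [T0], where [x] is small. *)
  set (T0 := M0 + 1).
  set (T1 := Rmax (M1 + 1) (Rmax T0 1)).
  assert (HT1 : M1 + 1 <= T1 /\ T0 <= T1 /\ 1 <= T1).
  { unfold T1. pose proof (Rmax_r (M1 + 1) (Rmax T0 1)).
    pose proof (Rmax_l T0 1). pose proof (Rmax_r T0 1).
    pose proof (Rmax_l (M1 + 1) (Rmax T0 1)). lra. }
  set (c := Rmin (/ T1) ((a - b) / 4)).
  assert (HT1inv : 0 < / T1) by (apply Rinv_0_lt_compat; lra).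
  assert (Hc : 0 < c) by (apply Rmin_glb_lt; lra).
  assert (HcT1 : c * T1 <= 1).
  { rewrite <- (Rinv_l T1) by lra. apply Rmult_le_compat_r; [lra | apply Rmin_l]. }
  assert (Hcab : c <= (a - b) / 4) by apply Rmin_r.
  exists c. split; [exact Hc |]. exists T1. intros t Ht. apply Rlt_le.
  cut (0 < G g (x t) - c * t); [lra |].
  apply (no_first_zero (fun s => G g (x s) - c * s)
           (fun s => a - b * (g (x (s - tau s)) / g (x s)) - c) T0 T1); [| | | lra | lra].
  - intros s Hs. destruct (HM0 s) as [_ HG]; [unfold T0 in Hs; lra |].
    assert (c * s <= c * T1) by (apply Rmult_le_compat_l; lra). lra.
  - intros s Hs. apply (is_derive_minus (fun r => G g (x r)) (fun r => c * r)).
    + apply (HM1 s). lra.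
    + auto_derive; [exact I | ring].
  - intros s Hs Hpast Hzero.
    destruct (HM1 s ltac:(lra)) as [[H1 H2] [[H3 H4] _]].
    destruct (HM0 s) as [Hxs _]; [unfold T0 in HT1; lra |].
    destruct (HM0 (s - tau s)) as [Hxd _]; [lra |].
    specialize (Hpast (s - tau s) ltac:(unfold T0; lra)).
    assert (c * tau s <= c * (eps * s)) by (apply Rmult_le_compat_l; lra).
    assert (Hratio : g (x (s - tau s)) <= rho * g (x s)).
    { apply Hcmp; [exact Hxs | tauto |].
      replace (G g (x s)) with (c * s) by lra. lra. }
    apply Rle_div_l in Hratio; [| now apply Rlt_gt, (nonlinearity_pos _ _ Hg)].
    apply (Rmult_le_compat_l b) in Hratio; lra.
Qed.

(** [G g (x t)] grows at rate at most [a], so over the delay it gains at most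
    [a * tau t], which is negligible compared with [c * t <= G g (x t)]. *)
Lemma delayed_G_close (beta : R) (g : R -> R) (a b : R) (tau x : R -> R) (eps : R) :
  regular_nonlinearity beta g -> decaying_solution g a b tau x -> 0 < b < a ->
  0 < eps ->
  Rbar_locally p_infty (fun t => (1 - eps) * G g (x t) <= G g (x (t - tau t))).
Proof.
  intros Hg Hx Hab Heps.
  destruct (G_solution_linear_growth beta g a b tau x Hg Hx Hab) as [c [Hc Hgrow]].
  destruct (filter_and _ _ (G_solution_derive beta g a b tau x Hg Hx)
    (filter_and _ _ (solution_pos _ _ _ _ _ Hx)
      (delayed_time_p_infty _ _ _ _ _ Hx _ (solution_pos _ _ _ _ _ Hx)))) as [M HM].
  assert (Hback : Rbar_locally p_infty (fun t => M < t - tau t)).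
  { apply (delayed_time_p_infty _ _ _ _ _ Hx (fun r => M < r)). now exists M. }
  (* With [tau t <= eps * c / a * t] the gain [a * tau t] is at most
     [eps * (c * t)]. *)
  assert (Hd : 0 < eps * c / a).
  { apply Rdiv_lt_0_compat, Rlt_trans with b; try apply Rmult_lt_0_compat; lra. }
  generalize (filter_and _ _ (filter_and _ _ Hgrow Hback)
    (filter_and _ _ (delay_nonneg _ _ _ _ _ Hx)
       (delay_eventually_small _ _ _ _ _ _ Hx Hd))).
  apply filter_imp. intros t [[H1 H2] [H3 [H4 H5]]].
  assert (Hinc : G g (x t) - G g (x (t - tau t)) <= a * (t - (t - tau t))).
  { apply (increment_le (fun s => G g (x s))
             (fun s => a - b * (g (x (s - tau s)) / g (x s)))); [lra | |].
    - intros u Hu. apply (HM u). lra.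
    - intros u Hu. destruct (HM u ltac:(lra)) as [_ [Hp1 Hp2]].
      cut (0 <= b * (g (x (u - tau u)) / g (x u))); [lra |].
      apply Rmult_le_pos; [lra |].
      apply Rlt_le, Rdiv_lt_0_compat; now apply (nonlinearity_pos _ _ Hg). }
  assert (a * tau t <= a * (eps * c / a * t)) by (apply Rmult_le_compat_l; lra).
  replace (a * (eps * c / a * t)) with (eps * (c * t)) in H by (field; lra).
  assert (eps * (c * t) <= eps * G g (x t)) by (apply Rmult_le_compat_l; lra).
  lra.
Qed.

Lemma delayed_g_upper (beta : R) (g : R -> R) (a b : R) (tau x : R -> R) (rho : R) :
  regular_nonlinearity beta g -> decaying_solution g a b tau x -> 0 < b < a ->
  1 < rho ->
  Rbar_locally p_infty (fun t => g (x (t - tau t)) / g (x t) <= rho).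
Proof.
  intros Hg Hx Hab Hrho.
  destruct (G_comparison_controls_g beta g rho Hg Hrho) as [eps [eta [Heps [Heta Hcmp]]]].
  assert (Hsmall : Rbar_locally p_infty (fun t => 0 < x t < eta)).
  { exact (solution_at_right _ _ _ _ _ Hx _ (at_right_0_interval eta Heta)). }
  generalize (filter_and _ _ (filter_and _ _ Hsmall
      (delayed_time_p_infty _ _ _ _ _ Hx _ (solution_pos _ _ _ _ _ Hx)))
    (delayed_G_close beta g a b tau x eps Hg Hx Hab Heps)).
  apply filter_imp. intros t [[H1 H2] H3].
  apply Rle_div_l; [apply Rlt_gt, (nonlinearity_pos _ _ Hg); tauto |].
  now apply Hcmp.
Qed.

(** The upper bound with [rho = a / b] makes the derivative of [G g (x t)]
    nonnegative, so [x] is eventually nonincreasing and its delayed value is the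
    larger one. *)
Lemma delayed_g_lower (beta : R) (g : R -> R) (a b : R) (tau x : R -> R) :
  regular_nonlinearity beta g -> decaying_solution g a b tau x -> 0 < b < a ->
  Rbar_locally p_infty (fun t => 1 <= g (x (t - tau t)) / g (x t)).
Proof.
  intros Hg Hx Hab.
  assert (Hrho : 1 < a / b) by (apply Rlt_div_r; lra).
  destruct (nonlinearity_incr _ _ Hg) as [d [Hd Hincr]].
  assert (Hsmall : Rbar_locally p_infty (fun t => 0 < x t < d)).
  { exact (solution_at_right _ _ _ _ _ Hx _ (at_right_0_interval d Hd)). }
  destruct (filter_and _ _ (delayed_g_upper beta g a b tau x (a / b) Hg Hx Hab Hrho)
              (G_solution_derive beta g a b tau x Hg Hx)) as [M HM].
  assert (Hback : Rbar_locally p_infty (fun t => M < t - tau t)).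
  { apply (delayed_time_p_infty _ _ _ _ _ Hx (fun r => M < r)). now exists M. }
  generalize (filter_and _ _ (filter_and _ _ Hback (delay_nonneg _ _ _ _ _ Hx))
    (filter_and _ _ Hsmall (delayed_time_p_infty _ _ _ _ _ Hx _ Hsmall))).
  apply filter_imp. intros t [[H1 H2] [H3 H4]].
  assert (Hmono : 0 * (t - (t - tau t)) <= G g (x t) - G g (x (t - tau t))).
  { apply (increment_ge (fun s => G g (x s))
             (fun s => a - b * (g (x (s - tau s)) / g (x s)))); [lra | |].
    - intros u Hu. apply (HM u). lra.
    - intros u Hu. destruct (HM u ltac:(lra)) as [H5 _].
      apply (Rmult_le_compat_l b) in H5; [| lra].
      replace (b * (a / b)) with a in H5 by (field; lra). lra. }
  apply Rle_div_r; [apply Rlt_gt, (nonlinearity_pos _ _ Hg); tauto |].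
  rewrite Rmult_1_l. apply Hincr; [tauto | | tauto].
  apply (G_le_cancel beta g); [exact Hg | tauto | lra].
Qed.

Lemma G_solution_rate (beta : R) (g : R -> R) (a b : R) (tau x : R -> R) :
  regular_nonlinearity beta g -> decaying_solution g a b tau x -> 0 < b < a ->
  filterlim (fun t => G g (x t) / t) (Rbar_locally p_infty) (locally (a - b)).
Proof.
  intros Hg Hx Hab.
  apply (lhospital_p_infty (fun t => G g (x t)) (fun t => t)
           (fun t => a - b * (g (x (t - tau t)) / g (x t))) (fun _ => 1)).
  - now apply (G_solution_derive beta).
  - exists 0. intros t _. apply (@is_derive_id R_AbsRing).
  - exists 0. intros t _. exact Rlt_0_1.
  - apply filterlim_id.
  - apply (filterlim_locally_between R (Rbar_locally p_infty)). intros eps Heps.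
    assert (Hrho : 1 < 1 + eps / b).
    { assert (0 < eps / b) by (apply Rdiv_lt_0_compat; lra). lra. }
    generalize (filter_and _ _
      (delayed_g_upper beta g a b tau x (1 + eps / b) Hg Hx Hab Hrho)
      (delayed_g_lower beta g a b tau x Hg Hx Hab)).
    apply filter_imp. intros t [H1 H2].
    apply (Rmult_le_compat_l b) in H1; [| lra].
    apply (Rmult_le_compat_l b) in H2; [| lra].
    replace (b * (1 + eps / b)) with (b + eps) in H1 by (field; lra).
    unfold Rdiv at 1 3. rewrite Rinv_1. lra.
Qed.

(** As [G g] maps onto the positive half-line, the left inverse [Ginv] is also
    a right inverse there. *)
Lemma inverse_G_at_right (beta : R) (g Ginv : R -> R) :
  regular_nonlinearity beta g ->
  is_inverse_on (fun u => 0 < u) (G g) Ginv ->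
  filterlim Ginv (Rbar_locally p_infty) (at_right 0) /\
  forall t, 0 < t -> G g (Ginv t) = t.
Proof.
  intros Hg Hinv.
  assert (Hval : forall t, 0 < t -> 0 < Ginv t /\ G g (Ginv t) = t).
  { intros t Ht. destruct (G_onto beta g t Hg Ht) as [u [Hu HGu]].
    assert (E : Ginv t = u) by (rewrite <- HGu; now apply Hinv).
    rewrite E. now split. }
  split; [| intros t Ht; now apply Hval].
  intros P HP. apply at_right_0_inv in HP. destruct HP as [eps [Heps HP]].
  exists (Rmax 0 (G g eps)). intros t Ht.
  pose proof (Rmax_l 0 (G g eps)). pose proof (Rmax_r 0 (G g eps)).
  destruct (Hval t ltac:(lra)) as [H1 H2].
  apply HP. split; [exact H1 |].
  apply (G_lt_cancel beta g); [assumption | exact Heps | lra].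
Qed.

(** [Ginv t] is compared with [x t] through [G g (Ginv t) = t]; the limit is the
    [L] with [L ^ (1 - beta) = a - b]. *)
Lemma solution_ratio_to_inverse_G (beta : R) (g Ginv : R -> R) (a b : R) (tau x : R -> R) :
  regular_nonlinearity beta g -> decaying_solution g a b tau x -> 0 < b < a ->
  is_inverse_on (fun u => 0 < u) (G g) Ginv ->
  filterlim (fun t => x t / Ginv t) (Rbar_locally p_infty)
    (locally (Rpower (a - b) (- (1 / (beta - 1))))).
Proof.
  intros Hg Hx Hab Hinv. pose proof (exponent_gt_1 _ _ Hg) as Hbeta.
  destruct (inverse_G_at_right beta g Ginv Hg Hinv) as [Hlim HG].
  apply (ratio_limit_from_G beta g R (Rbar_locally p_infty) _ x Ginv);
    [exact Hg | apply exp_pos | exact (solution_pos _ _ _ _ _ Hx) | exact Hlim |].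
  rewrite Rpower_mult.
  replace (- (1 / (beta - 1)) * (1 - beta)) with 1 by (field; lra).
  rewrite Rpower_1 by lra.
  apply (filterlim_ext_loc (fun t => G g (x t) / t)).
  - exists 0. intros t Ht. now rewrite HG.
  - now apply (G_solution_rate beta g a b tau).
Qed.

Theorem theorem5 :
  forall (tau : R -> R) (taubar : R) (a b : R) (g : R -> R) (beta : R)
         (psi x : R -> R),
    (forall t, 0 <= t -> 0 <= tau t) ->
    continuous_on (fun t => 0 <= t) tau ->
    is_lim (fun t => t - tau t) p_infty p_infty ->
    is_glb_Rbar (fun s => exists t, 0 <= t /\ s = t - tau t)
      (Finite (- taubar)) ->
    is_lim (fun t => tau t / t) p_infty (Finite 0) ->
    0 < b -> b < a ->
    (forall u, 0 <= u -> 0 <= g u) ->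
    continuous_on (fun u => 0 <= u) g ->
    g 0 = 0 ->
    (forall u, 0 < u -> 0 < g u) ->
    (exists delta1, 0 < delta1 /\
       forall u v, 0 < u -> u < v -> v < delta1 -> g u <= g v) ->
    1 < beta ->
    RV0 beta g ->
    continuous_on (fun t => - taubar <= t <= 0) psi ->
    (forall t, - taubar <= t <= 0 -> 0 < psi t) ->
    is_solution tau g a b taubar psi x ->
    is_lim x p_infty (Finite 0) ->
    is_lim (fun t => G g (x t) / t) p_infty (Finite (a - b)) /\
    (forall Ginv : R -> R,
       is_inverse_on (fun u => 0 < u) (G g) Ginv ->
       is_lim (fun t => x t / Ginv t) p_infty
         (Finite (Rpower (a - b) (- (1 / (beta - 1)))))).
Proof.
  intros tau taubar a b g beta psi x Htau _ Hback _ Htau0 Hb Hba _ Hgc _ Hgpos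
    [d [Hd Hincr]] Hbeta [_ Hrv] _ _ [Hxpos [_ [Hxd _]]] Hx0.
  assert (Hg : regular_nonlinearity beta g).
  { split; [exact Hbeta | | exact Hgpos | | exact Hrv].
    - intros u Hu P HP. unfold filtermap.
      assert (Hnear : locally u (fun v => 0 <= v)).
      { apply (locally_interval _ u 0 p_infty); [exact Hu | exact I |].
        intros v Hv _. now apply Rlt_le. }
      generalize (filter_and _ _ Hnear (Hgc u (Rlt_le _ _ Hu) P HP)).
      apply filter_imp. intros v [H1 H2]. exact (H2 H1).
    - exists d. split; [exact Hd |]. intros u v Hu Huv Hv.
      destruct (Rle_lt_or_eq_dec _ _ Huv) as [| ->]; [now apply Hincr | lra]. }
  assert (Hx : decaying_solution g a b tau x).
  { split; [| | exact Hx0 | | exact Hback | exact Htau0].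
    - exists (- taubar). intros t Ht. apply Hxpos. lra.
    - exists 0. exact Hxd.
    - exists 0. intros t Ht. apply Htau. lra. }
  split.
  - now apply (G_solution_rate beta g a b tau x).
  - intros Ginv Hinv. now apply (solution_ratio_to_inverse_G beta g Ginv a b tau x).
Qed.
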